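(* Suppose that (i) $g_0(\boldsymbol\gamma)$ is polyhedral with parameter $\rho=\Theta(1)>0$, i.e. $g_0(\boldsymbol\gamma_0^* )\ge g_0(\boldsymbol\gamma)+\rho\|\boldsymbol\gamma_0^*-\boldsymbol\gamma\|$ for all $\boldsymbol\gamma$, and (ii) $\boldsymbol q(t)$ has a countable state space under the algorithm OLAC2. Let $T_{D_p}=\inf\{t:\|\boldsymbol q(t)-\boldsymbol\gamma^*\|\le D_p\}$, where $D_p=\frac{B-\eta^2}{2(\rho-\eta)}=\Theta(1)$ with $0<\eta<\rho$, $\eta=\Theta(1)$. Then, with a sufficiently large $V$, with probability at least $1-\frac{M}{V^{4\log(V)}}$, under OLAC2 (with parameter $c\in[0,1)$, $T_l=V^c$), $$\mathbb E\{T_{D_p}\}=O\!\left(V^{1-c/2}\log(V)+V^c\right).$$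
   Context: **Model.** Time is slotted, $t=0,1,2,\dots$; there are $r\ge1$ queues. The network state $S(t)$ is i.i.d. over time with values in $\{s_1,\dots,s_M\}$, $\pi_{s_i}=\Pr\{S(t)=s_i\}$, $\boldsymbol\pi=(\pi_{s_1},\dots,\pi_{s_M})$. The controller observes $S(t)$ at the start of slot $t$ but does not know $\boldsymbol\pi$. If $S(t)=s_i$ it chooses an action $x(t)$ in a time-invariant compact set $\mathcal X^{(s_i)}$; an action $x$ gives cost $f(t)=f(s_i,x)$ (costs are all in $\mathbb R_+$, or all in $\mathbb R_-$ for reward maximization problems), traffic $A_j(t)=A_j(s_i,x)\ge0$ to queue $j$, and service $\mu_j(t)=\mu_j(s_i,x)\ge0$ to queue $j$. The magnitudes of all functions $f,A_j,\mu_j$ are bounded by a constant $\delta_{\max}\in(0,\infty)$, and the functions are known to the controller. Queues: $q_j(t+1)=\max[q_j(t)-\mu_j(t)+A_j(t),0]$, $\boldsymbol q(0)=\boldsymbol0$. A feasible policy is stable if $\limsup_{t\to\infty}\frac1t\sum_{\tau<t}\sum_j\mathbb E\{q_j(\tau)\}<\infty$; $f^*_{\mathrm{av}}$ is the optimal (minimal) value of $\limsup_{t\to\infty}\frac1t\sum_{\tau<t}\mathbb E\{f(\tau)\}$ over all stable policies. $B:=\frac r2\delta_{\max}^2$, and the paper takes $\|\boldsymbol\mu(t)-\boldsymbol A(t)\|\le B$ at all times. $\|\cdot\|$ is the Euclidean norm. **Dual functions.** $V\ge1$ is a parameter. For $\boldsymbol\gamma\in\mathbb R^r$, $g_{s_i}(\boldsymbol\gamma)=\inf_{x\in\mathcal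 X^{(s_i)}}\{Vf(s_i,x)+\sum_j\gamma_j[A_j(s_i,x)-\mu_j(s_i,x)]\}$ and $g(\boldsymbol\gamma)=\sum_{s_i}\pi_{s_i}g_{s_i}(\boldsymbol\gamma)$. $g_0$ denotes $g$ with $V=1$; $\boldsymbol\gamma^*$ and $\boldsymbol\gamma_0^*$ denote maximizers over $\boldsymbol\gamma\succeq\boldsymbol0$ of $g$ and $g_0$ respectively, with $\boldsymbol\gamma^*=V\boldsymbol\gamma_0^*$. **Standing assumptions.** (A1) There is $\epsilon_s=\Theta(1)>0$ such that for every state distribution $\boldsymbol\pi'$ with $\|\boldsymbol\pi'-\boldsymbol\pi\|\le\epsilon_s$ there are actions $x_k^{(s_i)}\in\mathcal X^{(s_i)}$ and weights $\vartheta_k^{(s_i)}\ge0$, $k=1,2,\dots$, with $\sum_k\vartheta_k^{(s_i)}=1$ for all $s_i$ (possibly depending on $\boldsymbol\pi'$), with $\sum_{s_i}\pi'_{s_i}\sum_k\vartheta_k^{(s_i)}[A_j(s_i,x_k^{(s_i)})-\mu_j(s_i,x_k^{(s_i)})]\le-\eta_0$ for all $j$, where $\eta_0=\Theta(1)>0$ is independent of $\boldsymbol\pi'$. (A2) There are actions $x_k^{(s_i)*}\in\mathcal X^{(s_i)}$ and weights $\vartheta_k^{(s_i)*}\ge0$ with $\sum_k\vartheta_k^{(s_i)*}=1$ for all $s_i$, such that $\sum_{s_i}\pi_{s_i}\sum_k\vartheta_k^{(s_i)*}f(s_i,x_k^{(s_i)*})=f^*_{\mathrm{av}}$ and $\sum_{s_i}\pi_{s_i}\sum_k\vartheta_k^{(s_i)*}[A_j(s_i,x_k^{(s_i)*})-\mu_j(s_i,x_k^{(s_i)*})]=0$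 for all $j$. (A3) $\boldsymbol\gamma_0^*$ is the unique maximizer of $g_0$ in $\mathbb R^r$. **Algorithm OLAC2.** Fix $c\in[0,1)$ and $T_l=V^c$. Let $\pi_{s_i}(t)=N_{s_i}(t)/t$, where $N_{s_i}(t)$ is the number of slots in $\{0,\dots,t-1\}$ with $S=s_i$. In every slot $t$: (1) if $S(t)=s_i$, choose $x\in\mathcal X^{(s_i)}$ maximizing $-Vf(s_i,x)+\sum_jq_j(t)[\mu_j(s_i,x)-A_j(s_i,x)]$; (2) update the queues by the queue dynamics with the Last-In-First-Out discipline; (3) only at $t=T_l$: let $\tilde{\boldsymbol\beta}$ be an optimal solution of $\max_{\boldsymbol\beta\succeq\boldsymbol0}\sum_{s_i}\pi_{s_i}(T_l-1)g_{s_i}(\boldsymbol\beta)$ and set $\boldsymbol q(T_l)=\tilde{\boldsymbol\beta}$, by dropping packets from queue $j$ if $q_j(T_l-1)>\tilde\beta_j$ or adding null packets if $q_j(T_l-1)<\tilde\beta_j$. $O(\cdot)$ and $\Theta(\cdot)$ are with respect to $V$; in particular $\Theta(1)$ means a constant not depending on $V$.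
   Formalization: The case c = 0 is excluded: there T_l = 1, and the distribution π(T_l − 1) = π(0) = N(0)/0 used by OLAC2 is undefined; V^c is rounded up to an integer slot, which must exceed 1 (automatic for c > 0 and V > 1). *)

(* Defs.v *)
From HB Require Import structures.
From mathcomp Require Import all_boot all_order all_algebra.
From mathcomp Require Import all_classical all_reals all_analysis.
Import Order.TTheory GRing.Theory Num.Theory.
Import numFieldNormedType.Exports.

Set Implicit Arguments.
Unset Strict Implicit.
Unset Printing Implicit Defensive.

Local Open Scope classical_set_scope.
Local Open Scope ring_scope.

(* The norm of 'rV[R]_n provided by the library is the sup norm. *)
Definition enorm (R : realType) (n : nat) (v : 'rV[R]_n) : R :=
  Num.sqrt (\sum_(i < n) v 0 i ^+ 2).

Definition nonneg_vec (R : realType) (n : nat) (v : 'rV[R]_n) : Prop :=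
  forall i, 0 <= v 0 i.

Definition distribution_vec (R : realType) (M : nat) (p : 'rV[R]_M) : Prop :=
  nonneg_vec p /\ \sum_(s < M) p 0 s = 1.

(* A network with M states and r queues.  The action sets of the different
   states are subsets of one topological space. *)
Record network (R : realType) (r M : nat) := Network {
  action : topologicalType ;
  feasible : 'I_M -> set action ;
  cost : 'I_M -> action -> R ;
  arrival : 'I_M -> action -> 'rV[R]_r ;
  service : 'I_M -> action -> 'rV[R]_r }.

Arguments feasible {R r M} n _ _.
Arguments cost {R r M} n _ _.
Arguments arrival {R r M} n _ _.
Arguments service {R r M} n _ _.

Definition boundB (R : realType) (r : nat) (dmax : R) : R :=
  r%:R / 2 * dmax ^+ 2.

Record network_ok (R : realType) (r M : nat) (N : network R r M) (dmax : R)
    : Prop := NetworkOk {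
  feasible_compact : forall s, compact (feasible N s) ;
  cost_sign : (forall s x, feasible N s x -> 0 <= cost N s x) \/
              (forall s x, feasible N s x -> cost N s x <= 0) ;
  arrival_ge0 : forall s x, feasible N s x -> nonneg_vec (arrival N s x) ;
  service_ge0 : forall s x, feasible N s x -> nonneg_vec (service N s x) ;
  dmax_gt0 : 0 < dmax ;
  cost_bounded : forall s x, feasible N s x -> `|cost N s x| <= dmax ;
  arrival_bounded :
    forall s x, feasible N s x -> forall j, `|arrival N s x 0 j| <= dmax ;
  service_bounded :
    forall s x, feasible N s x -> forall j, `|service N s x 0 j| <= dmax ;
  drift_bounded : forall s x, feasible N s x ->
    enorm (service N s x - arrival N s x) <= boundB r dmax }.

Section Dual.
Variables (R : realType) (r M : nat) (N : network R r M).

Definition lagrangian (V : R) (s : 'I_M) (gam : 'rV[R]_r) (x : action N) : R :=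
  V * cost N s x + \sum_(j < r) gam 0 j * (arrival N s x 0 j - service N s x 0 j).

Definition dual_state (V : R) (s : 'I_M) (gam : 'rV[R]_r) : R :=
  inf [set lagrangian V s gam x | x in feasible N s].

Definition dual (p : 'rV[R]_M) (V : R) (gam : 'rV[R]_r) : R :=
  \sum_(s < M) p 0 s * dual_state V s gam.

Definition dual_opt (p : 'rV[R]_M) (V : R) (b : 'rV[R]_r) : Prop :=
  nonneg_vec b /\ forall b', nonneg_vec b' -> dual p V b' <= dual p V b.

Definition unique_dual_max (p : 'rV[R]_M) (V : R) (b : 'rV[R]_r) : Prop :=
  (forall b', dual p V b' <= dual p V b) /\
  (forall b', (forall b'', dual p V b'' <= dual p V b') -> b' = b).

Definition polyhedral (p : 'rV[R]_M) (gam0 : 'rV[R]_r) (rho : R) : Prop :=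
  forall gam, dual p 1 gam + rho * enorm (gam0 - gam) <= dual p 1 gam0.

End Dual.

Section Randomized.
Variables (R : realType) (r M : nat) (N : network R r M).

(* For each state, a probability distribution on countably many actions. *)
Definition randomization (x : 'I_M -> nat -> action N) (th : 'I_M -> nat -> R)
    : Prop :=
  forall s, [/\ forall k, feasible N s (x s k), forall k, 0 <= th s k
              & series (th s) @ \oo --> (1 : R)].

Definition mixed_mean (p : 'rV[R]_M) (x : 'I_M -> nat -> action N)
    (th : 'I_M -> nat -> R) (h : 'I_M -> action N -> R) : R :=
  \sum_(s < M) p 0 s * limn (series (fun k => th s k * h s (x s k))).

Definition net_input (j : 'I_r) (s : 'I_M) (x : action N) : R :=
  arrival N s x 0 j - service N s x 0 j.

Definition slackness (p : 'rV[R]_M) (eps_s eta0 : R) : Prop :=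
  forall p', distribution_vec p' -> enorm (p' - p) <= eps_s ->
  exists x th, randomization x th /\
    forall j, mixed_mean p' x th (net_input j) <= - eta0.

End Randomized.

Section Control.
Variables (R : realType) (r M : nat) (N : network R r M) (p : 'rV[R]_M).
Variables (d : measure_display) (Om : measurableType d) (P : probability Om R).

Definition measurable_wrt (G : set (set Om)) (h : Om -> R) : Prop :=
  preimage_set_system setT h measurable `<=` G.

(* F t collects the events known before slot t (past states, past decisions and
   any randomization used so far).  The state S t is independent of F t and has
   law p, which makes the states i.i.d. with law p and the decisions
   non-anticipating.  The action space carries no sigma-algebra: what has to be
   measurable is the cost, the traffic and the service resulting from x t. *)
Record feasible_control (S : nat -> Om -> 'I_M) (x : nat -> Om -> action N)
    (F : nat -> set (set Om)) : Prop := FeasibleControl {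
  filtration_sigma : forall t, sigma_algebra setT (F t) ;
  filtration_measurable : forall t, F t `<=` measurable ;
  filtration_mono : forall t, F t `<=` F t.+1 ;
  state_known : forall t s, F t.+1 [set w | S t w = s] ;
  state_iid : forall t s E, F t E ->
    P (E `&` [set w | S t w = s]) = (P E * (p 0 s)%:E)%E ;
  action_feasible : forall t w, feasible N (S t w) (x t w) ;
  cost_known : forall t,
    measurable_wrt (F t.+1) (fun w => cost N (S t w) (x t w)) ;
  arrival_known : forall t j,
    measurable_wrt (F t.+1) (fun w => arrival N (S t w) (x t w) 0 j) ;
  service_known : forall t j,
    measurable_wrt (F t.+1) (fun w => service N (S t w) (x t w) 0 j) }.

Definition queue_step (q mu a : 'rV[R]_r) : 'rV[R]_r :=
  \row_j Num.max (q 0 j - mu 0 j + a 0 j) 0.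

Definition queue_process (S : nat -> Om -> 'I_M) (x : nat -> Om -> action N)
    (q : nat -> Om -> 'rV[R]_r) : Prop :=
  (forall w, q 0%N w = 0) /\
  (forall t w, q t.+1 w =
     queue_step (q t w) (service N (S t w) (x t w)) (arrival N (S t w) (x t w))).

Definition time_average (u : nat -> \bar R) (t : nat) : \bar R :=
  ((t%:R^-1)%:E * \sum_(tau < t) u tau)%E.

Definition stable (q : nat -> Om -> 'rV[R]_r) : Prop :=
  (limn_esup (time_average (fun tau =>
     \sum_(j < r) 'E_P[fun w => q tau w 0%R j])) < +oo)%E.

Definition average_cost (S : nat -> Om -> 'I_M) (x : nat -> Om -> action N)
    : \bar R :=
  limn_esup (time_average (fun tau =>
    ('E_P[fun w => cost N (S tau w) (x tau w)])%E)).

End Control.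

(* The infimum ranges over all probability spaces carrying a stable policy, so
   that policies may use any amount of randomization. *)
Definition fav (R : realType) (r M : nat) (N : network R r M) (p : 'rV[R]_M)
    : \bar R :=
  ereal_inf [set v : \bar R |
    exists (d : measure_display) (Om : measurableType d)
      (P : probability Om R) (S : nat -> Om -> 'I_M)
      (x : nat -> Om -> action N) (F : nat -> set (set Om))
      (q : nat -> Om -> 'rV[R]_r),
      [/\ feasible_control p P S x F, queue_process S x q, stable P q
        & v = average_cost P S x]].

Definition balanced_optimum (R : realType) (r M : nat) (N : network R r M)
    (p : 'rV[R]_M) : Prop :=
  exists (x : 'I_M -> nat -> action N) (th : 'I_M -> nat -> R),
    [/\ randomization x th,
        (mixed_mean p x th (cost N))%:E = fav N p
      & forall j, mixed_mean p x th (net_input (N := N) j) = 0].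

(* V^c rounded up to a slot number. *)
Definition learning_time (R : realType) (V c : R) : nat :=
  `|Num.ceil (V `^ c)|%N.

Section OLAC2.
Variables (R : realType) (r M : nat) (N : network R r M) (p : 'rV[R]_M).
Variables (d : measure_display) (Om : measurableType d) (P : probability Om R).

Definition empirical (S : nat -> Om -> 'I_M) (t : nat) (w : Om) : 'rV[R]_M :=
  \row_s ((\sum_(tau < t) (S tau w == s))%N%:R / t%:R).

(* [learning_defined]: the distribution learned at time T is the empirical one
   at time T - 1, a ratio with denominator T - 1, so it exists only if 1 < T.
   For V > 1 this excludes exactly c = 0.
   [learned_opt]: on an atypical sample the learned dual problem may be
   unbounded; beta is then left arbitrary.
   Only the queue sizes are modelled: the order of service (LIFO) does not
   affect them. *)
Record olac2 (V c : R) (S : nat -> Om -> 'I_M) (x : nat -> Om -> action N)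
    (F : nat -> set (set Om)) (beta : Om -> 'rV[R]_r)
    (q : nat -> Om -> 'rV[R]_r) : Prop := Olac2 {
  olac2_control : feasible_control p P S x F ;
  olac2_action : forall t w y, feasible N (S t w) y ->
    - V * cost N (S t w) y + \sum_(j < r) q t w 0 j *
        (service N (S t w) y 0 j - arrival N (S t w) y 0 j) <=
    - V * cost N (S t w) (x t w) + \sum_(j < r) q t w 0 j *
        (service N (S t w) (x t w) 0 j - arrival N (S t w) (x t w) 0 j) ;
  learning_defined : (1 < learning_time V c)%N ;
  learned_opt : forall w,
    let phat := empirical S (learning_time V c).-1 w in
    (exists b, dual_opt N phat V b) -> dual_opt N phat V (beta w) ;
  learned_known : forall j,
    measurable_wrt (F (learning_time V c)) (fun w => beta w 0 j) ;
  queue_init : forall w, q 0%N w = 0 ;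
  queue_reset : forall w, q (learning_time V c) w = beta w ;
  queue_next : forall t w, t.+1 <> learning_time V c -> q t.+1 w =
    queue_step (q t w) (service N (S t w) (x t w)) (arrival N (S t w) (x t w)) }.

Definition countable_states (q : nat -> Om -> 'rV[R]_r) : Prop :=
  exists Q : set 'rV[R]_r, countable Q /\ forall t w, Q (q t w).

(* +oo when the ball is never reached. *)
Definition hitting_time (q : nat -> Om -> 'rV[R]_r) (gam : 'rV[R]_r) (D : R)
    (w : Om) : \bar R :=
  ereal_inf [set (t%:R)%:E | t in [set t : nat | enorm (q t w - gam) <= D]].

Definition same_states (S : nat -> Om -> 'I_M) (T : nat) (w : Om) : set Om :=
  [set w' | forall tau, (tau < T)%N -> S tau w' = S tau w].

(* E[tau | S 0, ..., S (T - 1)] at the sample point w; the conditioning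
   variables take finitely many values, so this is an elementary quotient. *)
Definition cond_mean (S : nat -> Om -> 'I_M) (T : nat) (tau : Om -> \bar R)
    (w : Om) : \bar R :=
  ((fine (P (same_states S T w)))^-1%:E *
   \int[P]_(w' in same_states S T w) tau w')%E.

End OLAC2.

(* Main.v *)
(** Each [g_s] is Lipschitz with a constant that depends neither on [V] nor on
    [s].  Hence replacing the weights [p] by an empirical distribution within a
    small constant [eps] of [p] changes the increment [g(b) - g(gam)] by less
    than [rho * |b - gam|], and the polyhedral condition survives: [gam] is
    still the unique maximizer of the learned dual.  On such a sample the reset
    puts the queue exactly at [gam], and the ball is reached by time
    [T = O(V^c)].  An exponential Chernoff bound with the fixed deviation [eps]
    makes the exceptional event smaller than [M / V^(4 log V)] as soon as [V^c]
    dominates [log^2 V]. *)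
Require Import Defs.
From HB Require Import structures.
From mathcomp Require Import all_boot all_order all_algebra.
From mathcomp Require Import all_classical all_reals all_analysis.
From mathcomp Require Import ring lra.

Set Implicit Arguments.
Unset Strict Implicit.
Unset Printing Implicit Defensive.

Import Order.TTheory GRing.Theory Num.Theory.
Import numFieldNormedType.Exports.
Local Open Scope classical_set_scope.
Local Open Scope ring_scope.

(** * Exponential tail bounds for words of independent letters *)

Lemma expR_le_quadratic (R : realType) (x : R) :
  x <= 1 / 2 -> expR x <= 1 + x + 2 * x ^+ 2.
Proof.
(* The tangent bound at [- x] gives [expR x <= 1 / (1 - x)]; the quadratic exceeds this, the gap
   times [1 - x] being [x ^+ 2 * (1 - 2 * x)]. *)
move=> hx; have h := expR_ge1Dx (- x).
have := expR_gt0 x; have e : expR x * expR (- x) = 1.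
  by rewrite -expRD subrr expR0.
move=> e0.
have h1 : expR x * (1 - x) <= 1 by rewrite -[leRHS]e ler_pM2l.
have h2 : 1 <= (1 + x + 2 * x ^+ 2) * (1 - x).
  have : 0 <= x ^+ 2 * (1 - 2 * x) by apply: mulr_ge0; [exact: sqr_ge0|lra].
  have -> : (1 + x + 2 * x ^+ 2) * (1 - x) = 1 + x ^+ 2 * (1 - 2 * x) by ring.
  by move=> ?; lra.
have x1 : 0 < 1 - x by lra.
by rewrite -(ler_pM2r x1) (le_trans h1 h2).
Qed.

Section Chernoff.
Variables (R : realType) (M : nat) (p : 'rV[R]_M).
Hypothesis hp : distribution_vec p.

(** In the quadratic bound for [expR (lam * Z s)] the linear term averages to zero, and
    [1 + u <= expR u] closes. *)
Lemma mgf_le (Z : 'I_M -> R) (lam : R) :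
  \sum_s p 0 s * Z s = 0 -> (forall s, `|Z s| <= 1) -> 0 <= lam <= 1 / 2 ->
  \sum_s p 0 s * expR (lam * Z s) <= expR (2 * lam ^+ 2).
Proof.
move=> Z0 Z1 /andP[l0 l2]; have [p0 p1] := hp.
apply: (@le_trans _ _ (\sum_s p 0 s * (1 + lam * Z s + 2 * lam ^+ 2))).
  apply: ler_sum => s _; apply: ler_wpM2l => //.
  have /ler_normlP[Za Zb] := Z1 s.
  apply: (le_trans (@expR_le_quadratic _ _ _)); first by nra.
  have : Z s ^+ 2 <= 1 by nra.
  have : 0 <= lam ^+ 2 by apply: sqr_ge0.
  rewrite exprMn; nra.
rewrite (eq_bigr (fun s => p 0 s * (1 + 2 * lam ^+ 2) + lam * (p 0 s * Z s)));
  last by move=> s _; ring.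
rewrite big_split /= -mulr_suml -mulr_sumr Z0 p1 mulr0 addr0 mul1r.
exact: expR_ge1Dx.
Qed.

(** Markov's inequality for [expR (lam * \sum_i Z (f i))], stated on the finite set of words so that
    no integration is involved. *)
Lemma finite_chernoff (Z : 'I_M -> R) (eps : R) (n : nat) :
  \sum_s p 0 s * Z s = 0 -> (forall s, `|Z s| <= 1) -> 0 <= eps <= 1 ->
  \sum_(f : {ffun 'I_n -> 'I_M} | n%:R * eps <= \sum_i Z (f i))
     \prod_i p 0 (f i) <= expR (- (n%:R * eps ^+ 2 / 8)).
Proof.
move=> Z0 Z1 /andP[e0 e1]; have [p0 p1] := hp.
(* The minimizer of [2 * lam ^+ 2 - lam * eps], with minimum [- eps ^+ 2 / 8]. *)
pose lam := eps / 4.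
have l0 : 0 <= lam by rewrite /lam; lra.
apply: (@le_trans _ _ (\sum_(f : {ffun 'I_n -> 'I_M})
  expR (- (lam * (n%:R * eps))) * \prod_i (p 0 (f i) * expR (lam * Z (f i))))).
  rewrite big_mkcond /=; apply: ler_sum => f _.
  have pf : 0 <= \prod_i p 0 (f i) by apply: prodr_ge0.
  rewrite big_split /= mulrCA -expR_sum -mulr_sumr -expRD.
  case: ifP => [hf|_]; last by rewrite mulr_ge0 // expR_ge0.
  rewrite -[leLHS]mulr1 ler_wpM2l // -[leLHS]expR0 ler_expR.
  by rewrite addrC subr_ge0 ler_wpM2l.
rewrite -mulr_sumr.
(* Independence: the sum over words of a product is the [n]-th power of the one-letter sum. *)
rewrite -(bigA_distr_bigA (fun (_ : 'I_n) s => p 0 s * expR (lam * Z s))) /=.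
rewrite prodr_const card_ord.
apply: (@le_trans _ _ (expR (- (lam * (n%:R * eps))) * expR (2 * lam ^+ 2) ^+ n)).
  rewrite ler_wpM2l ?expR_ge0 // lerXn2r ?nnegrE ?expR_ge0 //=.
    by apply: sumr_ge0 => s _; rewrite mulr_ge0 // expR_ge0.
  by apply: mgf_le => //; rewrite l0 /= /lam; lra.
rewrite -expRM_natl -expRD ler_expR /lam.
rewrite le_eqVlt; apply/orP; left; apply/eqP; by field.
Qed.

(** The one-sided bound is applied to the centred indicator of [s] and to its negative, whence the
    factor 2. *)
Lemma frequency_tail (eps : R) (n : nat) (s : 'I_M) :
  0 <= eps <= 1 ->
  \sum_(f : {ffun 'I_n -> 'I_M} |
      n%:R * eps < `|(\sum_i (f i == s))%N%:R - n%:R * p 0 s|)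
     \prod_i p 0 (f i) <= 2 * expR (- (n%:R * eps ^+ 2 / 8)).
Proof.
move=> he; have [p0 p1] := hp.
pose Z (a : 'I_M) : R := (a == s)%:R - p 0 s.
have ps1 : p 0 s <= 1.
  by rewrite -p1 (bigD1 s) //= lerDl; apply: sumr_ge0.
have Zs : \sum_a p 0 a * Z a = 0.
  rewrite /Z; under eq_bigr do rewrite mulrBr.
  rewrite sumrB -mulr_suml p1 mul1r (bigD1 s) //= eqxx mulr1 big1 ?addr0 ?subrr //.
  by move=> a /negbTE ->; rewrite mulr0.
have Z1 a : `|Z a| <= 1.
  by rewrite /Z; apply/ler_normlP; have := p0 s; case: (a == s) => /=; split; lra.
have Zf (f : {ffun 'I_n -> 'I_M}) :
    (\sum_i (f i == s))%N%:R - n%:R * p 0 s = \sum_i Z (f i).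
  by rewrite /Z sumrB natr_sum sumr_const card_ord mulr_natl.
have h1 := @finite_chernoff Z eps n Zs Z1 he.
have h2 : \sum_(f : {ffun 'I_n -> 'I_M} | n%:R * eps <= \sum_i (- Z (f i)))
     \prod_i p 0 (f i) <= expR (- (n%:R * eps ^+ 2 / 8)).
  apply: (@finite_chernoff (fun a => - Z a)) => // [|a]; last by rewrite normrN.
  by under eq_bigr do rewrite mulrN; rewrite sumrN Zs oppr0.
rewrite mulrDl !mul1r.
apply: le_trans (lerD h1 h2).
rewrite big_mkcond [X in _ <= X + _]big_mkcond [X in _ <= _ + X]big_mkcond.
rewrite -big_split /=.
apply: ler_sum => f _; rewrite Zf sumrN.
have pf : 0 <= \prod_i p 0 (f i) by apply: prodr_ge0.
rewrite lter_normr; set z := \sum_i _.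
case: (boolP (n%:R * eps < z)) => [/ltW -> /=|_].
  by rewrite lerDl; case: ifP.
case: (boolP (n%:R * eps < - z)) => [/ltW -> /=|_ /=].
  by rewrite lerDr; case: ifP.
by rewrite addr_ge0 //; case: ifP.
Qed.

End Chernoff.

(** * Events determined by finitely many observed states *)

Section Histories.
Variables (R : realType) (r M : nat) (N : network R r M) (p : 'rV[R]_M).
Variables (d : measure_display) (Om : measurableType d) (P : probability Om R).
Variables (S : nat -> Om -> 'I_M) (x : nat -> Om -> action N).
Variable F : nat -> set (set Om).
Hypothesis ctrl : feasible_control p P S x F.

Definition cylinder (n : nat) (f : {ffun 'I_n -> 'I_M}) : set Om :=
  [set w | forall i : 'I_n, S i w = f i].

(** Induction on [n]: the prefix event lies in [F n], of which the state in slot [n] is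
    independent. *)
Lemma cylinder_known (n : nat) (f : {ffun 'I_n -> 'I_M}) :
  F n (cylinder f) /\ P (cylinder f) = (\prod_i p 0 (f i))%:E.
Proof.
have sF t := (sigma_algebraP (fun X _ => @subsetT _ X)).1 (filtration_sigma ctrl t).
elim: n f => [|n IH] f.
  have -> : cylinder f = setT by apply/seteqP; split => // w _ [].
  by rewrite big_ord0 probability_setT; split => //; case: (sF 0%N).
pose f' := [ffun i : 'I_n => f (widen_ord (leqnSn n) i)].
have -> : cylinder f = cylinder f' `&` [set w | S n w = f ord_max].
  apply/seteqP; split => [w h|w [h1 h2] i] /=.
    by split=> [i|]; rewrite ?ffunE -h.
  case: (ltnP i n) => hi.
    have := h1 (Ordinal hi); rewrite ffunE /= => ->.
    by congr (f _); apply: val_inj.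
  have -> : i = ord_max by apply: val_inj; apply/eqP; rewrite eqn_leq hi -ltnS ltn_ord.
  exact: h2.
have [F1 P1] := IH f'; split.
  have [_ _ _ FI] := sF n.+1.
  by apply: FI; [exact: (filtration_mono ctrl)|exact: (state_known ctrl)].
rewrite (state_iid ctrl) // P1 big_ord_recr /= -EFinM.
by congr ((_ * _)%:E); apply: eq_bigr => i _; rewrite ffunE.
Qed.

Lemma measurable_cylinder n (f : {ffun 'I_n -> 'I_M}) : measurable (cylinder f).
Proof. exact: (filtration_measurable ctrl (cylinder_known f).1). Qed.

Lemma cylinder_same_states n w :
  cylinder [ffun i : 'I_n => S i w] = same_states S n w.
Proof.
apply/seteqP; split => [w' h i hi|w' h i] /=; last by rewrite ffunE h.
by have := h (Ordinal hi); rewrite ffunE.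
Qed.

(** Such a set is a finite union of cylinders. This gives measurability of events whose definition
    involves the hitting time, without measurability of the latter. *)
Lemma measurable_history n (A : set Om) :
  (forall w w', A w -> same_states S n w w' -> A w') -> measurable A.
Proof.
move=> hA.
have -> : A = \bigcup_(f in [set f : {ffun 'I_n -> 'I_M} | cylinder f `<=` A])
    cylinder f.
  apply/seteqP; split => [w Aw|w [f /= fA]]; last exact: fA.
  exists [ffun i : 'I_n => S i w]; rewrite /= cylinder_same_states => //.
  by move=> w'; exact: hA.
apply: fin_bigcup_measurable; first exact: finite_finset.
by move=> f _; exact: measurable_cylinder.
Qed.

(** Carries the estimates on words over to [P], by subadditivity over the cylinders that cover the
    event. *)
Lemma history_event_le n (Q : pred {ffun 'I_n -> 'I_M}) :
  (P [set w | Q [ffun i : 'I_n => S i w]] <=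
   (\sum_(f | Q f) \prod_i p 0 (f i))%:E)%E.
Proof.
set A := [set w | _].
have mA : measurable A.
  apply: (@measurable_history n) => w w'; rewrite /A /= => Qw h.
  suff <- : [ffun i : 'I_n => S i w] = [ffun i : 'I_n => S i w'] by [].
  by apply/ffunP => i; rewrite !ffunE h.
apply: (@le_trans _ _ (\sum_(f \in [set` enum Q]) P (cylinder f))%E).
  apply: content_sub_fsum => //.
  - by move=> f _; exact: measurable_cylinder.
  - move=> w Qw; exists [ffun i : 'I_n => S i w]; first by rewrite /= mem_enum.
    by rewrite cylinder_same_states.
rewrite -fsbig_seq ?enum_uniq // big_enum_cond /= -sumEFin.
rewrite le_eqVlt; apply/orP; left; apply/eqP.
apply: eq_big => [f|f _]; first by rewrite andbT.
exact: (cylinder_known f).2.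
Qed.

Lemma empirical_tail (hp : distribution_vec p) (eps : R) (n : nat) :
  0 <= eps <= 1 -> (0 < n)%N ->
  (P [set w | exists s, (eps < `|empirical R S n w 0 s - p 0 s|)%R] <=
   (M%:R * (2 * expR (- (n%:R * eps ^+ 2 / 8))))%:E)%E.
Proof.
move=> he n0; have [p0 _] := hp.
have nR : 0 < n%:R :> R by rewrite ltr0n.
pose q s (f : {ffun 'I_n -> 'I_M}) : bool :=
  n%:R * eps < `|(\sum_i (f i == s))%N%:R - n%:R * p 0 s|.
have -> : [set w | exists s, eps < `|empirical R S n w 0 s - p 0 s|] =
    [set w | [exists s, q s [ffun i : 'I_n => S i w]]].
  have E w s : (eps < `|empirical R S n w 0 s - p 0 s|) =
      q s [ffun i : 'I_n => S i w].
    rewrite /q mxE; under [in RHS]eq_bigr do rewrite ffunE.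
    rewrite -[in LHS](ltr_pM2l nR) -[X in X * `|_|](gtr0_norm nR) -normrM mulrBr.
    by rewrite mulrCA divff ?mulr1 // gt_eqF.
  by apply/seteqP; split => w /=; [case=> s; rewrite E => h; apply/existsP; exists s
    |case/existsP => s; rewrite -E => h; exists s].
apply: (le_trans (@history_event_le n (fun f => [exists s, q s f]))).
rewrite lee_fin.
apply: (@le_trans _ _ (\sum_(s < M) \sum_(f | q s f) \prod_i p 0 (f i))).
  (* Union bound over [s]: after the exchange, each bad word is counted once for every state that
     makes it bad. *)
  rewrite (exchange_big_dep (fun f : {ffun 'I_n -> 'I_M} => [exists s, q s f])) /=;
    last by move=> s f _ h; apply/existsP; exists s.
  apply: ler_sum => f /existsP[s qs].
  have pf : 0 <= \prod_i p 0 (f i) by apply: prodr_ge0.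
  by rewrite (bigD1 s) //= lerDl; apply: sumr_ge0.
apply: (@le_trans _ _ (\sum_(s < M) 2 * expR (- (n%:R * eps ^+ 2 / 8)))).
  by apply: ler_sum => s _; exact: frequency_tail.
by rewrite sumr_const card_ord -[leLHS]mulr_natl.
Qed.

Lemma cond_mean_le (tau : Om -> \bar R) (T : nat) (K : R) w :
  0 <= K -> (forall w', 0 <= tau w')%E ->
  (forall w', same_states S T w w' -> tau w' <= K%:E)%E ->
  (cond_mean P S T tau w <= K%:E)%E.
Proof.
move=> K0 tau0 tauK; rewrite /cond_mean.
set A := same_states S T w.
have mA : measurable A by rewrite /A -cylinder_same_states; exact: measurable_cylinder.
have I : (\int[P]_(w' in A) tau w' <= K%:E * P A)%E.
  rewrite -(integral_cst P mA).
  (* Since [tau] is not assumed measurable, the integrals are compared through their definition as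
     suprema over simple functions. *)
  rewrite !ge0_integralE //=.
  apply: ereal_sup_le => _ [h /= hle <-]; exists h => //= y.
  apply: (le_trans (hle y)); rewrite /patch; case: ifP => // /set_mem; exact: tauK.
have finA : P A \is a fin_num by rewrite fin_num_measure.
have PA0 : 0 <= fine (P A) by rewrite fine_ge0.
apply: (le_trans (lee_wpmul2l _ I)); first by rewrite lee_fin invr_ge0.
move: finA {PA0 I}; case: (P A) => // a _ /=; rewrite -!EFinM lee_fin.
(* On a null history the quotient takes the default value 0, which is why [0 <= K] is assumed. *)
have [->|nz] := eqVneq a 0; first by rewrite invr0 mul0r.
by rewrite mulrCA mulVf // mulr1.
Qed.

End Histories.

(** * Homogeneity, Lipschitz continuity and stability of the dual function *)

Section Dual.
Variables (R : realType) (r M : nat) (N : network R r M) (dmax : R).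
Hypothesis hN : network_ok N dmax.
Implicit Types (V : R) (s : 'I_M) (g h : 'rV[R]_r).

Lemma lagrangian_bounded V s g :
  has_lbound [set lagrangian V s g x | x in feasible N s].
Proof.
exists (- (`|V| * dmax + \sum_j `|g 0 j| * (dmax + dmax))) => _ [x fx <-].
rewrite /lagrangian lerNl opprD.
apply: (le_trans (ler_norm _)); apply: (le_trans (ler_normD _ _)).
rewrite !normrN normrM lerD ?ler_wpM2l //; first exact: (cost_bounded hN).
apply: (le_trans (ler_norm_sum _ _ _)); apply: ler_sum => j _.
rewrite normrM ler_wpM2l //; apply: (le_trans (ler_normB _ _)).
by rewrite lerD // ?(arrival_bounded hN) ?(service_bounded hN).
Qed.

Lemma dual_state_ge V s g y : feasible N s !=set0 ->
  (forall x, feasible N s x -> y <= lagrangian V s g x) ->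
  y <= dual_state N V s g.
Proof.
move=> [x0 fx0] hy; apply: lb_le_inf; first by exists (lagrangian V s g x0), x0.
by move=> _ [x fx <-]; exact: hy.
Qed.

Lemma dual_state_le V s g x : feasible N s x ->
  dual_state N V s g <= lagrangian V s g x.
Proof. by move=> fx; apply: ge_inf; [exact: lagrangian_bounded|exists x]. Qed.

(** [network_ok] permits empty action sets; there the infimum defaults to 0, and the scaling and
    Lipschitz estimates hold trivially. *)
Lemma dual_state_empty V s g : ~ (feasible N s !=set0) -> dual_state N V s g = 0.
Proof.
move=> /nonemptyPn E.
by rewrite /dual_state E image_set0 inf0.
Qed.

Lemma le_dual_stateZ (a V : R) s g : 0 < a ->
  a * dual_state N V s g <= dual_state N (a * V) s (a *: g).
Proof.
move=> a0; have [ne|E] := pselect (feasible N s !=set0); last first.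
  by rewrite !dual_state_empty // mulr0.
apply: dual_state_ge => // x fx.
have -> : lagrangian (a * V) s (a *: g) x = a * lagrangian V s g x.
  rewrite /lagrangian mulrDr mulrA mulr_sumr; congr (_ + _).
  by apply: eq_bigr => j _; rewrite mxE mulrA.
by rewrite ler_pM2l // dual_state_le.
Qed.

(** The missing inequality is the previous one with factor [a^-1] at the scaled point. *)
Lemma dual_stateZ (a V : R) s g : 0 < a ->
  dual_state N (a * V) s (a *: g) = a * dual_state N V s g.
Proof.
move=> a0; apply/eqP; rewrite eq_le le_dual_stateZ // andbT.
rewrite -ler_pdivrMl //.
have ai : 0 < a^-1 by rewrite invr_gt0.
apply: (le_trans (le_dual_stateZ (a * V) s (a *: g) ai)).
by rewrite scalerA !mulrA mulVf ?gt_eqF // mul1r scale1r.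
Qed.

Lemma abs_le_enorm n (v : 'rV[R]_n) j : `|v 0 j| <= enorm v.
Proof.
rewrite /enorm -sqrtr_sqr ler_wsqrtr // (bigD1 j) //= lerDl.
by apply: sumr_ge0 => i _; exact: sqr_ge0.
Qed.

Lemma enorm_eq0 n (v : 'rV[R]_n) : enorm v <= 0 -> v = 0.
Proof.
move=> h; apply/rowP => j; rewrite mxE; apply/eqP.
by rewrite -normr_le0 (le_trans (abs_le_enorm v j)).
Qed.

Lemma enormZ n (a : R) (v : 'rV[R]_n) : 0 <= a -> enorm (a *: v) = a * enorm v.
Proof.
move=> a0; rewrite /enorm; under eq_bigr do rewrite mxE exprMn.
by rewrite -mulr_sumr sqrtrM ?sqr_ge0 // sqrtr_sqr ger0_norm.
Qed.

Lemma enormN n (v : 'rV[R]_n) : enorm (- v) = enorm v.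
Proof. by rewrite /enorm; under eq_bigr do rewrite mxE sqrrN. Qed.

Definition dual_lipschitz : R := r%:R * (dmax + dmax).

(** At a common action the terms [V * cost] cancel, so the difference of the Lagrangians is linear
    in [h - g] with coefficients at most [dmax + dmax]. *)
Lemma le_dual_state_lipschitz V s g h :
  dual_state N V s h - dual_lipschitz * enorm (g - h) <= dual_state N V s g.
Proof.
have d0 := ltW (dmax_gt0 hN).
have [ne|E] := pselect (feasible N s !=set0); last first.
  rewrite !dual_state_empty // sub0r oppr_le0 mulr_ge0 ?sqrtr_ge0 //.
  by rewrite mulr_ge0 // addr_ge0.
apply: dual_state_ge => // x fx; rewrite lerBlDr.
apply: (le_trans (dual_state_le _ _ fx)); rewrite -lerBlDl.
have -> : lagrangian V s h x - lagrangian V s g x =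
    \sum_j (h - g) 0 j * (arrival N s x 0 j - service N s x 0 j).
  rewrite /lagrangian opprD addrACA subrr add0r -sumrB.
  by apply: eq_bigr => j _; rewrite !mxE mulrBl.
have -> : dual_lipschitz * enorm (g - h) =
    \sum_(j < r) enorm (g - h) * (dmax + dmax).
  by rewrite sumr_const card_ord -mulr_natl /dual_lipschitz; ring.
apply: ler_sum => j _; apply: (le_trans (ler_norm _)); rewrite normrM.
apply: ler_pM => //; first by rewrite -enormN opprB abs_le_enorm.
apply: (le_trans (ler_normB _ _)).
by rewrite lerD // ?(arrival_bounded hN) ?(service_bounded hN).
Qed.

Lemma dual_state_lipschitz V s g h :
  `|dual_state N V s g - dual_state N V s h| <= dual_lipschitz * enorm (g - h).
Proof.
rewrite ler_norml lerBrDr addrC le_dual_state_lipschitz /=.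
by have := le_dual_state_lipschitz V s h g; rewrite -enormN opprB; lra.
Qed.

(** Dual and norm are both homogeneous of degree one, so passing from 1 to [V] keeps the slope
    [rho]. *)
Lemma polyhedralZ p gam0 rho V : 0 < V -> polyhedral N p gam0 rho ->
  forall g, dual N p V g + rho * enorm (V *: gam0 - g) <= dual N p V (V *: gam0).
Proof.
move=> V0 hpoly g.
have dualZ b : dual N p V (V *: b) = V * dual N p 1 b.
  rewrite /dual mulr_sumr; apply: eq_bigr => s _.
  by rewrite -[in dual_state _ V](mulr1 V) dual_stateZ // mulrCA.
have -> : g = V *: (V^-1 *: g) by rewrite scalerA divff ?gt_eqF // scale1r.
rewrite -scalerBr enormZ ?(ltW V0) // !dualZ mulrCA -mulrDr ler_pM2l //.
Qed.

(** Increments from [gam] are compared, because dual values may grow with [V]. A positive slope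
    [rho - M%:R * eps * dual_lipschitz] survives. *)
Lemma dual_opt_perturb (p p' : 'rV[R]_M) V gam rho eps :
  nonneg_vec gam ->
  (forall g, dual N p V g + rho * enorm (gam - g) <= dual N p V gam) ->
  (forall s, `|p' 0 s - p 0 s| <= eps) -> M%:R * eps * dual_lipschitz < rho ->
  dual_opt N p' V gam /\ forall b, dual_opt N p' V b -> b = gam.
Proof.
move=> gam_ge0 sharp close small.
have sharp' g : dual N p' V g + (rho - M%:R * eps * dual_lipschitz) *
    enorm (gam - g) <= dual N p' V gam.
  have L : (dual N p' V g - dual N p' V gam) - (dual N p V g - dual N p V gam) <=
      M%:R * eps * dual_lipschitz * enorm (gam - g).
    rewrite /dual -!sumrB.
    have -> : M%:R * eps * dual_lipschitz * enorm (gam - g) =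
        \sum_(s < M) eps * (dual_lipschitz * enorm (gam - g)).
      by rewrite sumr_const card_ord -mulr_natl; ring.
    apply: ler_sum => s _; rewrite -!mulrBr -mulrBl.
    apply: (le_trans (ler_norm _)); rewrite normrM ler_pM //.
    by rewrite -(enormN (gam - g)) opprB dual_state_lipschitz.
  by have := sharp g; lra.
have pos : 0 < rho - M%:R * eps * dual_lipschitz by lra.
have opt : dual_opt N p' V gam.
  split=> // g _; apply: le_trans (sharp' g).
  by rewrite lerDl mulr_ge0 ?sqrtr_ge0 // ltW.
split=> // b [_ bopt]; have := le_trans (sharp' b) (bopt _ gam_ge0).
rewrite gerDl pmulr_rle0 // => /enorm_eq0 /eqP.
by rewrite subr_eq0 => /eqP.
Qed.

End Dual.

(** * The learning time and the size of the failure probability *)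

Lemma learning_time_itv (R : realType) (V c : R) :
  V `^ c <= (learning_time V c)%:R < V `^ c + 1.
Proof.
have e : (learning_time V c)%:R = (Num.ceil (V `^ c))%:~R :> R.
  rewrite /learning_time natr_absz ger0_norm // ceil_ge0.
  by apply: lt_le_trans (powR_ge0 V c); rewrite oppr_lt0.
rewrite e ceil_ge /=.
by have /andP[+ _] := ceil_itv (V `^ c); rewrite intrB ltrBlDr.
Qed.

(** With [y = c * ln V], the exponent [t * kappa] is at least cubic in [y] while [4 * ln V * ln V]
    is quadratic; the threshold on [V] is where the cubic wins. *)
Lemma tail_rate (R : realType) (c kappa V t : R) :
  0 < c -> 0 < kappa ->
  expR ((1 + 6 * (1 + 4 / c ^+ 2) / kappa) / c) <= V -> V `^ c - 1 <= t ->
  2 * expR (- (t * kappa)) <= (V `^ (4 * ln V))^-1.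
Proof.
move=> c0 k0 hV ht.
have V0 : 0 < V by apply: lt_le_trans hV; exact: expR_gt0.
set y := c * ln V.
have hy : 1 + 6 * (1 + 4 / c ^+ 2) / kappa <= y.
  by rewrite /y [leRHS]mulrC -ler_pdivrMr // -ler_expR lnK.
have b0 : 0 < 1 + 4 / c ^+ 2.
  by rewrite addr_gt0 // divr_gt0 // exprn_gt0.
have y1 : 1 <= y.
  apply: le_trans hy; rewrite lerDl; apply: divr_ge0; last exact: ltW.
  by apply: mulr_ge0 => //; exact: ltW.
have hky : 6 * (1 + 4 / c ^+ 2) <= kappa * y.
  rewrite [leRHS]mulrC -ler_pdivrMr //.
  by apply: le_trans hy; rewrite lerDr.
have ey : V `^ c = expR y by rewrite /powR gt_eqF.
have y3 : y ^+ 3 / 6 <= expR y - 1.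
  have := @expR_ge1Dxn _ y 2 (le_trans ler01 y1).
  have -> : 3`! = 6%N by [].
  by rewrite lerBrDl.
(* The summand 1 pays for the prefactor, as [2 <= expR 1]. *)
have q : 1 + 4 * ln V * ln V <= t * kappa.
  have k1 : kappa * (y ^+ 3 / 6) <= t * kappa.
    by rewrite mulrC ler_pM2r //; apply: (le_trans y3); rewrite -ey.
  apply: le_trans k1.
  have y2 : 0 <= y ^+ 2 by exact: sqr_ge0.
  have h := ler_wpM2r y2 hky.
  have e1 : 4 / c ^+ 2 * y ^+ 2 = 4 * ln V * ln V.
    by rewrite /y; field; rewrite gt_eqF.
  have e2 : 6 * (1 + 4 / c ^+ 2) * y ^+ 2 = 6 * (y ^+ 2 + 4 * ln V * ln V).
    by rewrite -e1; ring.
  have e3 : kappa * y * y ^+ 2 = 6 * (kappa * (y ^+ 3 / 6)) by field.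
  have y21 : 1 <= y ^+ 2 by rewrite expr_ge1 // (le_trans ler01).
  by rewrite e2 e3 ler_pM2l // in h; lra.
have -> : (V `^ (4 * ln V))^-1 = expR (- (4 * ln V * ln V)).
  by rewrite /powR gt_eqF // expRN.
apply: (@le_trans _ _ (expR 1 * expR (- (t * kappa)))).
  rewrite ler_pM2r ?expR_gt0 //.
  by have := @expR_ge1Dx R 1; lra.
by rewrite -expRD ler_expR; lra.
Qed.

(** * The hitting-time bound *)

Unset Implicit Arguments.

Theorem theorem5 (R : realType) (r M : nat) (hr : (0 < r)%N)
    (N : network R r M) (dmax : R) (hN : network_ok N dmax)
    (p : 'rV[R]_M) (hp : distribution_vec p)
    (eps_s eta0 : R) (heps : 0 < eps_s) (heta0 : 0 < eta0)
    (A1 : slackness N p eps_s eta0)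
    (A2 : balanced_optimum N p)
    (gam0 : 'rV[R]_r) (hgam0 : dual_opt N p 1 gam0)
    (A3 : unique_dual_max N p 1 gam0)
    (rho : R) (hrho : 0 < rho) (hpoly : polyhedral N p gam0 rho)
    (eta : R) (heta : 0 < eta < rho)
    (D : R) (hD : D = (boundB r dmax - eta ^+ 2) / (2 * (rho - eta)))
    (hD_Theta1 : 0 < D)
    (c : R) (hc : 0 <= c < 1) :
  exists C V0 : R, forall V : R, 1 <= V -> V0 <= V ->
  forall (d : measure_display) (Om : measurableType d) (P : probability Om R)
    (S : nat -> Om -> 'I_M) (x : nat -> Om -> action N)
    (F : nat -> set (set Om)) (beta : Om -> 'rV[R]_r)
    (q : nat -> Om -> 'rV[R]_r) (gam : 'rV[R]_r),
  olac2 p P V c S x F beta q ->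
  countable_states q ->
  dual_opt N p V gam -> gam = V *: gam0 ->
  ((1 - M%:R / V `^ (4 * ln V))%:E <=
   P [set w | cond_mean P S (learning_time V c) (hitting_time q gam D) w <=
              (C * (V `^ (1 - c / 2) * ln V + V `^ c))%:E])%E.
Proof.
set L := dual_lipschitz r dmax.
have L0 : 0 <= M%:R * L.
  by rewrite !mulr_ge0 // addr_ge0 // ltW // (dmax_gt0 hN).
(* Small enough for [dual_opt_perturb], and at most 1 as the Chernoff bound requires. *)
set eps := rho / (rho + M%:R * L).
have den0 : 0 < rho + M%:R * L by rewrite ltr_pwDl.
have eps0 : 0 < eps by rewrite divr_gt0.
have eps1 : eps <= 1 by rewrite ler_pdivrMr // mul1r lerDl.
have small : M%:R * eps * L < rho.
  have -> : M%:R * eps * L = rho * (M%:R * L) / (rho + M%:R * L).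
    by rewrite /eps; field; rewrite gt_eqF.
  by rewrite ltr_pdivrMr // ltr_pM2l // ltrDr.
set kappa := eps ^+ 2 / 8.
have kappa0 : 0 < kappa by rewrite divr_gt0 // exprn_gt0.
exists 2, (expR ((1 + 6 * (1 + 4 / c ^+ 2) / kappa) / c)).
move=> V V1 hV d Om P S x F beta q gam alg _ gam_opt gamE.
have V0 : 0 < V by exact: lt_le_trans V1.
have T1 := learning_defined alg.
set T := learning_time V c in T1 *.
have /andP[Tge Tlt] := learning_time_itv V c; rewrite -/T in Tge Tlt.
(* For [c = 0] one has [T < 2], against [learning_defined]. *)
have c0 : 0 < c.
  case/andP: hc; rewrite le_eqVlt => /orP[/eqP c0|//] _.
  by move: Tlt; rewrite -c0 powRr0 -mulr2n ltr_nat ltnNge T1.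
have ctrl := olac2_control alg.
have n0 : (0 < T.-1)%N by rewrite -ltnS prednK // ltnW.
have TnE : T%:R = T.-1%:R + 1 :> R by rewrite natr1 prednK // ltnW.
(* The learned distribution uses the first [T.-1] states, so [bad] is decided by the history on
   which [cond_mean] conditions. *)
set bad := [set w | exists s, eps < `|empirical R S T.-1 w 0 s - p 0 s|].
set good := [set w | _].
have hit_le w : ~ bad w -> (hitting_time q gam D w <= T%:R%:E)%E.
  move=> nbad; apply: ereal_inf_lbound; exists T => //=.
  have close s : `|empirical R S T.-1 w 0 s - p 0 s| <= eps.
    by rewrite leNgt; apply/negP => h; apply: nbad; exists s.
  have sharp g : dual N p V g + rho * enorm (gam - g) <= dual N p V gam.
    by rewrite gamE; exact: (polyhedralZ hN).
  have [opt uniq] := dual_opt_perturb hN (proj1 gam_opt) sharp close small.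
  have -> : q T w = gam.
    rewrite (queue_reset alg); apply: uniq; apply: (learned_opt alg).
    by exists gam.
  rewrite subrr /enorm big1 ?sqrtr0; first exact: ltW.
  by move=> i _; rewrite mxE expr0n.
have bad_local w w' : same_states S T.-1 w w' -> bad w' -> bad w.
  move=> h [s hs]; exists s; move: hs; rewrite !mxE.
  by under eq_bigr do rewrite h //.
have bad_good : ~` bad `<=` good.
  move=> w nbad; rewrite /good /=.
  (* The constant 2 absorbs the rounding: [T < V]^ c + 1[and]1 <= V [^ c]. *)
  have C0 : T%:R <= 2 * (V `^ (1 - c / 2) * ln V + V `^ c).
    have h1 : 0 <= V `^ (1 - c / 2) * ln V by rewrite mulr_ge0 ?powR_ge0 ?ln_ge0.
    have h2 : 1 <= V `^ c by rewrite -[leLHS](powRr0 V) ler_powR // ltW.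
    lra.
  apply: (@le_trans _ _ T%:R%:E); last by rewrite lee_fin.
  apply: (cond_mean_le ctrl) => // [w'|w' h].
    by apply: le_ereal_inf_tmp => _ [t _ <-]; rewrite lee_fin.
  (* Every sample sharing the history of [w] also avoids [bad], so the bound [T] holds on the whole
     conditioning set. *)
  apply: hit_le => /bad_local b; apply: nbad; apply: b => i hi.
  by apply: h; rewrite (leq_trans hi) // leq_pred.
(* [cond_mean] is constant on each history of length [T]. *)
have mgood : measurable good.
  apply: (measurable_history ctrl (n := T)) => w w'; rewrite /good /= => hw h.
  suff -> : cond_mean P S T (hitting_time q gam D) w' =
            cond_mean P S T (hitting_time q gam D) w by [].
  suff e : same_states S T w' = same_states S T w by rewrite /cond_mean e.
  by apply/seteqP; split => u hu i hi; rewrite hu // h.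
have mbad : measurable bad.
  apply: (measurable_history ctrl (n := T.-1)) => w w' b h.
  by apply: bad_local b => i hi; rewrite h.
have Pbad : (P bad <= (M%:R / V `^ (4 * ln V))%:E)%E.
  apply: (le_trans (empirical_tail ctrl hp _ n0)); first by rewrite (ltW eps0).
  rewrite lee_fin ler_wpM2l // -mulrA.
  by apply: (tail_rate c0) => //; rewrite lerBlDr -TnE.
apply: (@le_trans _ _ (P (~` bad))); last first.
  by apply: le_measure => //; rewrite inE //; exact: measurableC.
by rewrite probability_setC // EFinB leeB.
Qed.
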